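(* Consider the sensor connectivity game with $N$ sensors with positions $x_i\in\mathbb R^2$ and costs $$f_i(\mathbf x)=x_i^Tr_{ii}x_i+x_i^Tr_i+b_i+\sum_{j\in\mathcal N_i^p}c_{ij}\|x_i-x_j\|^2,\quad i\in\mathcal N,$$ where each $r_{ii}$ is symmetric positive definite and strictly diagonally dominant and $c_{ij}>0$, with sensor dynamics $\dot x_i=u_i+d_i(t)$, communication graph $\mathcal G$, and the closed-loop system given by the control law $u_i=-\frac{\partial f_i}{\partial x_i}(\mathbf y_i)-\hat z_i$ together with the consensus/observer dynamics for $y_{ij},\hat x_i,\hat z_i$ with gains depending on the parameters $\theta,\sigma>0$ (all described in the context). Suppose that the communication graph $\mathcal G$ is undirected and connected, and that for each $i\in\mathcal N$, $d_i$ is continuously differentiable with $\dot d_i(t)$ bounded for $t\ge t_0$. Then for any positive constant $v_1$ there exist positive constants $\theta^*$ (not depending on $v_1$) and $\sigma^*(v_1)$ such that for each $\theta\in(\theta^*,\infty)$ and each $\sigma\in(\sigma^*,\infty)$, for any initial condition there exists a constant $\bar T\ge t_0$ such that $$\|\mathcal E(t)\|\le v_1\quad\text{for all } t>\bar T.$$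
   Context: Game and dynamics. There are $N\ge2$ sensors, $\mathcal N=\{1,\dots,N\}$. Sensor $i$ has position $x_i=[x_{i1},x_{i2}]^T\in\mathbb R^2$, control input $u_i\in\mathbb R^2$, and dynamics $\dot x_i=u_i+d_i(t)$, $t\ge t_0$, where $d_i:[t_0,\infty)\to\mathbb R^2$ is an external disturbance and $t_0$ is the initial time; $\mathbf x=[x_1^T,\dots,x_N^T]^T$. In the costs, $r_{ii}\in\mathbb R^{2\times2}$, $r_i\in\mathbb R^2$, $b_i\in\mathbb R$, $c_{ij}>0$ are constants, and $\mathcal N_i^p\subseteq\mathcal N\setminus\{i\}$ is the physical neighbor set of sensor $i$ (the sensors on whose positions $f_i$ depends); it need not coincide with the neighbor set of $i$ in the communication graph. A Nash equilibrium is a profile $\mathbf x^*=(x_i^*,\mathbf x_{-i}^* )$ such that for every $i\in\mathcal N$, $f_i(x_i^*,\mathbf x_{-i}^* )\le f_i(x_i,\mathbf x_{-i}^* )$ for all $x_i\in\mathbb R^2$, where $\mathbf x_{-i}$ collects the positions of all sensors other than $i$. $\mathbf x^*$ denotes the (unique) Nash equilibrium of this game. Communication graph. $\mathcal G$ is a weighted graph with node set $\mathcal N$ and adjacency matrix $\mathcal A=[a_{ij}]$: $a_{ij}>0$ if $(j,i)$ is an edge, $a_{ij}=0$ otherwise, and $a_{ii}=0$. It is undirected if $a_{ij}=a_{ji}$ for all $i,j$; an undirected graph is connected if there is a path between any two distinct nodes. Seeking strategy. All of $y_{ij},\hat x_i,\hat z_i$ take values in $\mathbb R^2$. The control law is $$u_i=-\frac{\partial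 f_i}{\partial x_i}(\mathbf y_i)-\hat z_i,\qquad \frac{\partial f_i}{\partial x_i}(\mathbf y_i)=\frac{\partial f_i(\mathbf x)}{\partial x_i}\Big|_{\mathbf x=\mathbf y_i}\in\mathbb R^2,\quad \mathbf y_i=[y_{i1}^T,\dots,y_{iN}^T]^T,$$ where, for $i,j\in\mathcal N$, $$\dot y_{ij}=-\theta_{ij}\Big(\sum_{k=1}^N a_{ik}(y_{ij}-y_{kj})+a_{ij}(y_{ij}-x_j)\Big),$$ $$\dot{\hat x}_i=u_i+\hat z_i+\bar k_{i1}(x_i-\hat x_i),\qquad \dot{\hat z}_i=\bar k_{i2}(x_i-\hat x_i),$$ with $\bar k_{i1}=\sigma k_{i1}$, $\bar k_{i2}=\sigma^2k_{i2}$, $\theta_{ij}=\theta\bar\theta_{ij}$. Here $\bar\theta_{ij},k_{i1},k_{i2}$ are fixed positive constants and $\sigma,\theta$ are positive tuning parameters. Error variables. With $z_i=d_i(t)$, set $\zeta_{i1}=x_i-\hat x_i$, $\zeta_{i2}=z_i-\hat z_i$, $\xi_i=x_i-x_i^*$, $\eta_{ij}=y_{ij}-x_j$. Let $\zeta_1,\zeta_2,\xi\in\mathbb R^{2N}$ and $\eta\in\mathbb R^{2N^2}$ be the corresponding stacked column vectors, $\zeta=[\zeta_1^T,\zeta_2^T]^T$, and $\mathcal E=[\zeta^T,\eta^T,\xi^T]^T$. $\|\cdot\|$ is the Euclidean norm. *)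

(* Defs.v *)
(* MathComp / MathComp-Analysis. *)
From mathcomp Require Import all_boot all_order all_algebra.
From mathcomp Require Import all_classical all_reals all_analysis.
Import Order.TTheory GRing.Theory Num.Theory numFieldNormedType.Exports.

Set Implicit Arguments.
Unset Strict Implicit.
Unset Printing Implicit Defensive.

Local Open Scope classical_set_scope.
Local Open Scope ring_scope.

(* The library norm on matrices is the sup norm, hence this definition. *)
Definition enorm (R : realType) (n : nat) (v : 'cV[R]_n) : R :=
  Num.sqrt (\sum_(k < n) v k 0 ^+ 2).

Definition posdefmx (R : realType) (n : nat) (A : 'M[R]_n) : Prop :=
  A^T = A /\ forall v : 'cV[R]_n, v != 0 -> 0 < (v^T *m A *m v) 0 0.

Definition strict_diag_dominant (R : realType) (n : nat) (A : 'M[R]_n) : Prop :=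
  forall k, \sum_(l < n | l != k) `|A k l| < `|A k k|.

Definition profile (R : realType) (N : nat) := 'I_N -> 'cV[R]_2.

Definition deviate (R : realType) (N : nat) (x : profile R N) (i : 'I_N)
    (p : 'cV[R]_2) : profile R N :=
  fun j => if j == i then p else x j.

(* r_ii, r_i, b_i, c_ij and the physical neighbor sets. *)
Record game (R : realType) (N : nat) := Game {
  rquad : 'I_N -> 'M[R]_2;
  rlin : 'I_N -> 'cV[R]_2;
  bcst : 'I_N -> R;
  cwgt : 'I_N -> 'I_N -> R;
  pnbr : 'I_N -> {set 'I_N} }.

Record well_posed_game (R : realType) (N : nat) (G : game R N) : Prop := {
  rquad_posdef : forall i, posdefmx (rquad G i);
  rquad_dominant : forall i, strict_diag_dominant (rquad G i);
  cwgt_gt0 : forall i j, j \in pnbr G i -> 0 < cwgt G i j;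
  pnbr_irrefl : forall i, i \notin pnbr G i }.

Definition cost (R : realType) (N : nat) (G : game R N) (i : 'I_N)
    (x : profile R N) : R :=
  ((x i)^T *m rquad G i *m x i) 0 0 + ((x i)^T *m rlin G i) 0 0 + bcst G i
  + \sum_(j in pnbr G i) cwgt G i j * enorm (x i - x j) ^+ 2.

Definition is_nash (R : realType) (N : nat) (f : 'I_N -> profile R N -> R)
    (x : profile R N) : Prop :=
  forall (i : 'I_N) (p : 'cV[R]_2), f i x <= f i (deviate x i p).

(* The gradient with respect to the block x_i, evaluated at x = y. *)
Definition partial_grad (R : realType) (N : nat) (f : profile R N -> R)
    (i : 'I_N) (y : profile R N) : 'cV[R]_2 :=
  \col_k 'D_(delta_mx k 0) (fun p : 'cV[R]_2 => f (deviate y i p)) (y i).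

Record weighted_graph (R : realType) (N : nat) (A : 'M[R]_N) : Prop := {
  adj_ge0 : forall i j, 0 <= A i j;
  adj_irrefl : forall i, A i i = 0 }.

Definition undirected (R : realType) (N : nat) (A : 'M[R]_N) : Prop :=
  forall i j, A i j = A j i.

(* (i, j) is an edge iff a_ji > 0. *)
Definition edge (R : realType) (N : nat) (A : 'M[R]_N) : rel 'I_N :=
  fun i j => 0 < A j i.

Definition connected_graph (R : realType) (N : nat) (A : 'M[R]_N) : Prop :=
  forall i j, i != j -> connect (edge A) i j.

(* Derivative at t of a function of interest only on [t0, +oo[: two-sided for
   t0 < t, right derivative at t = t0. *)
Definition has_deriv_from (R : realType) (t0 : R) (n : nat)
    (f : R -> 'cV[R]_n) (t : R) (l : 'cV[R]_n) : Prop :=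
  (s - t)^-1 *: (f s - f t) @[s --> within `[t0, +oo[ t^'] --> l.

Definition C1_bounded_deriv_from (R : realType) (t0 : R) (n : nat)
    (f : R -> 'cV[R]_n) : Prop :=
  exists f' : R -> 'cV[R]_n,
    [/\ forall t, t0 <= t -> has_deriv_from t0 f t (f' t),
        {within `[t0, +oo[, continuous f'} &
        exists M : R, forall t, t0 <= t -> enorm (f' t) <= M].

(* The fixed constants \bar\theta_ij, k_i1, k_i2. *)
Record gains (R : realType) (N : nat) := Gains {
  thetabar : 'I_N -> 'I_N -> R;
  k1 : 'I_N -> R;
  k2 : 'I_N -> R }.

Record positive_gains (R : realType) (N : nat) (K : gains R N) : Prop := {
  thetabar_gt0 : forall i j, 0 < thetabar K i j;
  k1_gt0 : forall i, 0 < k1 K i;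
  k2_gt0 : forall i, 0 < k2 K i }.

Record state (R : realType) (N : nat) := State {
  pos : 'I_N -> 'cV[R]_2;
  est : 'I_N -> 'I_N -> 'cV[R]_2;
  xhat : 'I_N -> 'cV[R]_2;
  zhat : 'I_N -> 'cV[R]_2 }.

Definition control (R : realType) (N : nat) (f : 'I_N -> profile R N -> R)
    (i : 'I_N) (s : state R N) : 'cV[R]_2 :=
  - partial_grad (f i) i (est s i) - zhat s i.

Record closed_loop (R : realType) (N : nat) (f : 'I_N -> profile R N -> R)
    (A : 'M[R]_N) (K : gains R N) (theta sigma t0 : R)
    (d : 'I_N -> R -> 'cV[R]_2) (S : R -> state R N) : Prop := {
  pos_dyn : forall i t, t0 <= t ->
    has_deriv_from t0 (fun s => pos (S s) i) t (control f i (S t) + d i t);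
  est_dyn : forall i j t, t0 <= t ->
    has_deriv_from t0 (fun s => est (S s) i j) t
      (- (theta * thetabar K i j) *:
         (\sum_(k < N) A i k *: (est (S t) i j - est (S t) k j)
          + A i j *: (est (S t) i j - pos (S t) j)));
  xhat_dyn : forall i t, t0 <= t ->
    has_deriv_from t0 (fun s => xhat (S s) i) t
      (control f i (S t) + zhat (S t) i
       + (sigma * k1 K i) *: (pos (S t) i - xhat (S t) i));
  zhat_dyn : forall i t, t0 <= t ->
    has_deriv_from t0 (fun s => zhat (S s) i) t
      ((sigma ^+ 2 * k2 K i) *: (pos (S t) i - xhat (S t) i)) }.

(* The stacked error [zeta_1; zeta_2; eta; xi], where z_i denotes d_i(t). *)
Definition error (R : realType) (N : nat) (xstar : profile R N)
    (z : 'I_N -> 'cV[R]_2) (s : state R N) :=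
  let zeta1 := \mxcol_(i < N) (pos s i - xhat s i) in
  let zeta2 := \mxcol_(i < N) (z i - zhat s i) in
  let eta := \mxcol_(i < N) \mxcol_(j < N) (est s i j - pos s j) in
  let xi := \mxcol_(i < N) (pos s i - xstar i) in
  col_mx (col_mx zeta1 zeta2) (col_mx eta xi).

(* Main.v *)
Require Import Defs.
From mathcomp Require Import all_boot all_order all_algebra.
From mathcomp Require Import all_classical all_reals all_analysis.
From mathcomp Require Import ring lra.
Import Order.TTheory GRing.Theory Num.Theory numFieldNormedType.Exports.
Set Implicit Arguments.
Unset Strict Implicit.
Unset Printing Implicit Defensive.
Local Open Scope classical_set_scope.
Local Open Scope ring_scope.

(* The costs are quadratic, so the gradients are affine and vanish at the Nash
   equilibrium; the error system is therefore linear, driven only by the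
   derivative d' of the disturbance.  It is a cascade:
   - the observer error, rescaled to (sigma zeta_1, zeta_2), evolves by sigma
     times a fixed Hurwitz matrix plus (0, d'), independently of the rest;
   - xi decays because the pseudo-gradient, although not symmetric, is coercive
     for suitable diagonal weights w;
   - eta decays at rate theta, because, for each j, the Laplacian of the connected
     graph plus diag(a_ij)_i is coercive.
   The sum V of the three quadratic Lyapunov functions satisfies
   V' <= - V / M + C / sigma with M and C independent of theta and sigma, hence
   V is ultimately of order 1 / sigma. *)

(** * Euclidean norms of stacked vectors *)

Lemma enorm_ge0 (R : realType) (n : nat) (v : 'cV[R]_n) : 0 <= enorm v.
Proof. exact: sqrtr_ge0. Qed.

Lemma sqr_enorm (R : realType) (n : nat) (v : 'cV[R]_n) :
  enorm v ^+ 2 = \sum_(k < n) v k 0 ^+ 2.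
Proof. by rewrite sqr_sqrtr// sumr_ge0// => k _; rewrite sqr_ge0. Qed.

Lemma sqr_enormE (R : realType) (n : nat) (v : 'cV[R]_n) :
  enorm v ^+ 2 = (v^T *m v) 0 0.
Proof. by rewrite sqr_enorm mxE; apply: eq_bigr => k _; rewrite mxE expr2. Qed.

Lemma sqr_enorm_col_mx (R : realType) (m n : nat) (u : 'cV[R]_m) (v : 'cV[R]_n) :
  enorm (col_mx u v) ^+ 2 = enorm u ^+ 2 + enorm v ^+ 2.
Proof. by rewrite !sqr_enormE tr_col_mx mul_row_col mxE. Qed.

Lemma sqr_enorm_mxcol (R : realType) (m : nat) (p : 'I_m -> nat)
    (B : forall i, 'cV[R]_(p i)) :
  enorm (\mxcol_(i < m) B i) ^+ 2 = \sum_(i < m) enorm (B i) ^+ 2.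
Proof.
rewrite sqr_enormE tr_mxcol mul_mxrow_mxcol summxE.
by apply: eq_bigr => i _; rewrite sqr_enormE.
Qed.

(** The squared Euclidean norm of the stacked profile, kept as a double sum over coordinates so that
    all later estimates are termwise. *)
Definition psq (R : realType) (N : nat) (v : profile R N) : R :=
  \sum_(i < N) \sum_(k < 2) v i k 0 ^+ 2.

Lemma sqr_enorm_error (R : realType) (N : nat) (xstar z : profile R N)
    (s : state R N) :
  enorm (error xstar z s) ^+ 2 =
    psq (fun i => pos s i - xhat s i) + psq (fun i => z i - zhat s i)
    + (\sum_(i < N) psq (fun j => est s i j - pos s j)
       + psq (fun i => pos s i - xstar i)).
Proof.
rewrite /error !sqr_enorm_col_mx !sqr_enorm_mxcol /psq.
congr (_ + _ + (_ + _)); apply: eq_bigr => i _;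
  rewrite ?sqr_enorm_mxcol ?sqr_enorm //.
by apply: eq_bigr => j _; rewrite sqr_enorm.
Qed.

(** * The affine gradients of the quadratic costs *)

(** The linear part of coordinate [k] of the partial gradient of cost [i]; the constant part is
    [rlin]. *)
Definition grad_lin (R : realType) (N : nat) (G : game R N) (i : 'I_N)
    (k : 'I_2) (v : profile R N) : R :=
  2 * (rquad G i *m v i) k 0
  + 2 * \sum_(j in pnbr G i) cwgt G i j * (v i k 0 - v j k 0).

(** The expansion is exact because the cost is quadratic; symmetry of [rquad] merges the two cross
    terms. It serves both to compute the derivative and to test the Nash inequality. *)
Lemma cost_line (R : realType) (N : nat) (G : game R N) (hG : well_posed_game G)
    (i : 'I_N) (k : 'I_2) (y : profile R N) :
  exists B : R, forall h : R,
    cost G i (deviate y i (h *: delta_mx k 0 + y i)) =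
    cost G i (deviate y i (y i)) + h * (grad_lin G i k y + rlin G i k 0)
    + h ^+ 2 * B.
Proof.
have [hsym _] := rquad_posdef hG i.
set e : 'cV[R]_2 := delta_mx k 0.
have he (u : 'cV[R]_2) : e^T *m u = (u k 0)%:M.
  by rewrite trmx_delta -rowE [LHS]mx11_scalar mxE.
have tr (h : R) (u : 'cV[R]_2) : (h *: e + u)^T = h *: e^T + u^T.
  by rewrite linearD linearZ.
have D0 (a b : 'M[R]_1) : (a + b) 0 0 = a 0 0 + b 0 0 by rewrite mxE.
have Z0 c (a : 'M[R]_1) : (c *: a) 0 0 = c * a 0 0 by rewrite mxE.
have S0 (c : R) : (c%:M : 'M[R]_1) 0 0 = c by rewrite mxE eqxx.
exists ((e^T *m rquad G i *m e) 0 0 + \sum_(j in pnbr G i) cwgt G i j) => h.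
have quad : ((h *: e + y i)^T *m rquad G i *m (h *: e + y i)) 0 0 =
    ((y i)^T *m rquad G i *m y i) 0 0 + h * (2 * (rquad G i *m y i) k 0)
    + h ^+ 2 * (e^T *m rquad G i *m e) 0 0.
  have sym : (y i)^T *m rquad G i *m e = e^T *m (rquad G i *m y i).
    by rewrite he -[RHS]tr_scalar_mx -he !trmx_mul trmxK hsym.
  rewrite tr !mulmxDl !mulmxDr -!scalemxAl -!scalemxAr sym.
  rewrite -!mulmxA !he !(D0, Z0, S0); ring.
have lin : ((h *: e + y i)^T *m rlin G i) 0 0 =
    ((y i)^T *m rlin G i) 0 0 + h * rlin G i k 0.
  rewrite tr mulmxDl -scalemxAl he !(D0, Z0, S0); ring.
have dist : \sum_(j in pnbr G i) cwgt G i j *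
      enorm ((h *: e + y i) - deviate y i (h *: e + y i) j) ^+ 2 =
    \sum_(j in pnbr G i) cwgt G i j * enorm (y i - deviate y i (y i) j) ^+ 2
    + h * (2 * \sum_(j in pnbr G i) cwgt G i j * (y i k 0 - y j k 0))
    + h ^+ 2 * \sum_(j in pnbr G i) cwgt G i j.
  rewrite !mulr_sumr -!big_split /=; apply: eq_bigr => j hj.
  have nij : (j == i) = false.
    by apply/eqP => ji; move: hj; rewrite ji (negbTE (pnbr_irrefl hG i)).
  rewrite /deviate nij.
  have -> : h *: e + y i - y j = h *: e + (y i - y j) by rewrite addrA.
  have -> : y i k 0 - y j k 0 = (y i - y j) k 0 by rewrite !mxE.
  move: (y i - y j) => u.
  have sym : u^T *m e = e^T *m u.
    by rewrite he -[RHS]tr_scalar_mx -he trmx_mul trmxK.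
  have ee : e^T *m e = 1%:M by rewrite he /e mxE !eqxx.
  rewrite !sqr_enormE tr !mulmxDl !mulmxDr -!scalemxAl -!scalemxAr.
  rewrite sym ee he !(D0, Z0, S0); ring.
rewrite /cost /deviate eqxx quad lin dist /grad_lin; ring.
Qed.

Lemma partial_grad_cost (R : realType) (N : nat) (G : game R N)
    (hG : well_posed_game G) (i : 'I_N) (k : 'I_2) (y : profile R N) :
  partial_grad (cost G i) i y k 0 = grad_lin G i k y + rlin G i k 0.
Proof.
have [B hB] := cost_line hG i k y.
set D := RHS; rewrite mxE /derive; apply: cvg_lim => //.
have lim : (fun h : R => D + h * B) @ 0^' --> D.
  apply: cvg_trans (cvg_app _ (@nbhs_dnbhs _ 0)) _.
  rewrite -[X in _ --> X](_ : D + 0 * B = D); last by rewrite mul0r addr0.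
  by apply: cvgD; [exact: cvg_cst | apply: cvgM; [exact: cvg_id | exact: cvg_cst]].
apply: cvg_trans lim; apply: near_eq_cvg; near=> h.
have h0 : h != 0 by near: h; exact: nbhs_dnbhs_neq.
rewrite /= hB -/D /GRing.scale /=; field.
Unshelve. all: by end_near. Qed.

(** First-order condition: if the slope [D] were nonzero, the small deviation [h = - c * D] would
    strictly lower the cost. *)
Lemma grad_nash (R : realType) (N : nat) (G : game R N)
    (hG : well_posed_game G) (x : profile R N) (hx : is_nash (cost G) x)
    (i : 'I_N) (k : 'I_2) : grad_lin G i k x + rlin G i k 0 = 0.
Proof.
have [B hB] := cost_line hG i k x; set D := _ + _.
have dev : deviate x i (x i) = x.
  by apply/funext => j; rewrite /deviate; case: eqP => // ->.
have hD h : 0 <= h * (D + h * B).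
  have := hx i (h *: delta_mx k 0 + x i); rewrite hB dev; rewrite -/D; lra.
have [//|D0] := eqVneq D 0.
(* Small enough that [c * B < 1] whatever the sign of [B]. *)
pose c := (`|B| + 1)^-1.
have c0 : 0 < c by rewrite invr_gt0 ltr_wpDl.
have cB : c * B < 1.
  rewrite mulrC ltr_pdivrMr ?ltr_wpDl// mul1r.
  by rewrite (le_lt_trans (ler_norm _))// ltrDl.
have := hD (- c * D).
have -> : - c * D * (D + - c * D * B) = - (c * D ^+ 2 * (1 - c * B)) by ring.
rewrite oppr_ge0 leNgt mulr_gt0 ?subr_gt0// mulr_gt0//.
by rewrite lt_def sqrf_eq0 D0 sqr_ge0.
Qed.

Lemma grad_lin_sub (R : realType) (N : nat) (G : game R N) (i : 'I_N) (k : 'I_2)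
    (u v : profile R N) :
  grad_lin G i k (fun j => u j - v j) = grad_lin G i k u - grad_lin G i k v.
Proof.
rewrite /grad_lin.
have -> : (rquad G i *m (u i - v i)) k 0 =
  (rquad G i *m u i) k 0 - (rquad G i *m v i) k 0 by rewrite mulmxBr !mxE.
have -> : \sum_(j in pnbr G i) cwgt G i j * ((u i - v i) k 0 - (u j - v j) k 0) =
  \sum_(j in pnbr G i) cwgt G i j * (u i k 0 - u j k 0) -
  \sum_(j in pnbr G i) cwgt G i j * (v i k 0 - v j k 0).
  by rewrite -sumrB; apply: eq_bigr => j _; rewrite !mxE; ring.
ring.
Qed.

(** * Uniform bounds over finite index sets and domination by quadratic forms *)

Lemma finite_ubound (R : realType) (I : finType) (f : I -> R) :
  exists2 C, 0 < C & forall i, f i <= C.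
Proof.
(* A sum instead of a maximum: it also covers an empty index type, where the 1 keeps the bound
   positive. *)
exists (1 + \sum_i `|f i|) => [|i].
  by rewrite ltr_wpDr// sumr_ge0.
rewrite (bigD1 i)//= (le_trans (ler_norm _))// addrCA lerDl addr_ge0//.
exact: sumr_ge0.
Qed.

Lemma finite_lbound (R : realType) (I : finType) (f : I -> R) :
  (forall i, 0 < f i) -> exists2 c, 0 < c & forall i, c <= f i.
Proof.
move=> f0; have [C C0 hC] := finite_ubound (fun i => (f i)^-1).
by exists C^-1 => [|i]; rewrite ?invr_gt0// -[leRHS]invrK lef_pV2 ?posrE ?invr_gt0.
Qed.

Section QuadBounded.
Context {R : realType} {T : Type} (q : T -> R).

(** Since this domination is stable under sums and multiples, coercivity of a form [q] follows by
    checking each coordinate, with no eigenvalues or compactness. *)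
Definition quad_bounded (f : T -> R) :=
  exists2 C, 0 < C & forall v, f v ^+ 2 <= C * q v.

Hypothesis q_ge0 : forall v, 0 <= q v.

Lemma quad_boundedD (f g : T -> R) :
  quad_bounded f -> quad_bounded g -> quad_bounded (fun v => f v + g v).
Proof.
move=> [C C0 hC] [D D0 hD]; exists (2 * (C + D)) => [|v].
  by rewrite mulr_gt0 ?addr_gt0.
have := hC v; have := hD v; have := sqr_ge0 (f v - g v); lra.
Qed.

Lemma quad_boundedM (c : R) (f : T -> R) :
  quad_bounded f -> quad_bounded (fun v => c * f v).
Proof.
move=> [C C0 hC]; exists ((c ^+ 2 + 1) * C) => [|v].
  by rewrite mulr_gt0// ltr_wpDl// sqr_ge0.
rewrite exprMn -[leRHS]mulrA; apply: (le_trans (ler_wpM2l (sqr_ge0 c) (hC v))).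
by rewrite ler_wpM2r ?lerDl// mulr_ge0// ltW.
Qed.

Lemma quad_bounded_sum (I : Type) (s : seq I) (P : pred I) (f : I -> T -> R) :
  (forall i, quad_bounded (f i)) ->
  quad_bounded (fun v => \sum_(i <- s | P i) f i v).
Proof.
move=> hf; elim: s => [|i s [C C0 hC]].
  by exists 1 => // v; rewrite big_nil expr0n mul1r.
case Pi : (P i).
  have [D D0 hD] : quad_bounded (fun v => f i v + \sum_(i <- s | P i) f i v).
    by apply: quad_boundedD => //; exists C.
  by exists D => // v; rewrite big_cons Pi.
by exists C => // v; rewrite big_cons Pi.
Qed.

Lemma sum_quad_bounded (I : finType) (f : I -> T -> R) :
  (forall i, quad_bounded (f i)) ->
  exists2 C, 0 < C & forall v, \sum_i f i v ^+ 2 <= C * q v.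
Proof.
move=> hf.
have /choice[C hC] : forall i, exists C, forall v, f i v ^+ 2 <= C * q v.
  by move=> i; have [C _ hC] := hf i; exists C.
have [D D0 hD] := finite_ubound C.
exists (1 + \sum_(i : I) D) => [|v].
  by rewrite ltr_wpDr// sumr_ge0// => i _; exact: ltW.
rewrite mulrDl mul1r mulr_suml ler_wpDl// ler_sum// => i _.
by rewrite (le_trans (hC i v))// ler_wpM2r.
Qed.

End QuadBounded.

Lemma psq_ge0 (R : realType) (N : nat) (v : profile R N) : 0 <= psq v.
Proof. by apply: sumr_ge0 => i _; apply: sumr_ge0 => k _; exact: sqr_ge0. Qed.

Lemma coord_quad_bounded (R : realType) (N : nat) (i : 'I_N) (k : 'I_2) :
  quad_bounded (@psq R N) (fun v => v i k 0).
Proof.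
exists 1 => // v; rewrite mul1r /psq (bigD1 i)//= (bigD1 k)//= -addrA lerDl.
by rewrite addr_ge0// sumr_ge0// => j _; rewrite ?sumr_ge0// => *; exact: sqr_ge0.
Qed.

Lemma grad_lin_quad_bounded (R : realType) (N : nat) (G : game R N) (i : 'I_N)
    (k : 'I_2) : quad_bounded (@psq R N) (grad_lin G i k).
Proof.
have q0 := @psq_ge0 R N; rewrite /grad_lin.
apply: quad_boundedD; apply: (quad_boundedM q0).
  have -> : (fun v : profile R N => (rquad G i *m v i) k 0) =
      (fun v => \sum_l rquad G i k l * v i l 0).
    by apply/funext => v; rewrite mxE.
  apply: (quad_bounded_sum q0) => l; apply: (quad_boundedM q0).
  exact: coord_quad_bounded.
apply: (quad_bounded_sum q0) => j; apply: (quad_boundedM q0).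
have -> : (fun v : profile R N => v i k 0 - v j k 0) =
    (fun v => v i k 0 + (-1) * v j k 0).
  by apply/funext => v; rewrite mulN1r.
apply: quad_boundedD; [|apply: (quad_boundedM q0)];
  exact: coord_quad_bounded.
Qed.

(** Boundedness of the linear gradient map, obtained by treating the pairs [(i, k)] as one finite
    index. *)
Lemma grad_lin_sq_le (R : realType) (N : nat) (G : game R N) :
  exists2 C, 0 < C & forall v : profile R N,
    \sum_(i < N) \sum_(k < 2) grad_lin G i k v ^+ 2 <= C * psq v.
Proof.
have [C C0 hC] := @sum_quad_bounded R (profile R N) (@psq R N) (@psq_ge0 R N)
  ('I_N * 'I_2)%type (fun p => grad_lin G p.1 p.2)
  (fun p => grad_lin_quad_bounded G p.1 p.2).
by exists C => // v; rewrite pair_big; exact: hC.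
Qed.

(** * Coercivity of the weighted pseudo-gradient and of the grounded Laplacians *)

(* The weights are the left solution of w^T C = 1^T for the comparison matrix
   C = diag(rho + row sums of c) - c; by the minimum principle C is
   inverse-nonnegative, so they exist and are positive. *)
Lemma comparison_weights (R : realType) (n : nat) (c : 'I_n -> 'I_n -> R)
    (rho : 'I_n -> R) :
  (forall i j, 0 <= c i j) -> (forall i, 0 < rho i) ->
  exists2 w : 'I_n -> R, forall i, 0 < w i &
    forall j, w j * (rho j + \sum_l c j l) - \sum_i w i * c i j = 1.
Proof.
move=> c0 rho0.
pose C : 'M[R]_n := \matrix_(i, j) ((rho i + \sum_l c i l) *+ (i == j) - c i j).
have CE (v : 'cV[R]_n) i :
    (C *m v) i 0 = rho i * v i 0 + \sum_j c i j * (v i 0 - v j 0).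
  rewrite mxE; under eq_bigr do rewrite mxE mulrBl.
  rewrite sumrB (bigD1 i)//= eqxx [X in _ + X - _]big1 ?addr0; last first.
    by move=> j; rewrite eq_sym => /negbTE->; rewrite mul0r.
  under [in RHS]eq_bigr do rewrite mulrBr.
  rewrite sumrB -mulr_suml mulrDl; ring.
(* At an index [m] minimizing [v] all differences [v m - v j] are nonpositive, so
   [(C v)_m <= rho m * v m]. *)
have minpr (v : 'cV[R]_n) : (forall i, 0 <= (C *m v) i 0) -> forall i, 0 <= v i 0.
  move=> Cv i; have [m _ hm] := @arg_minP _ _ _ i xpredT (fun i => v i 0) isT.
  apply: le_trans (hm i isT); have := Cv m; rewrite CE => h.
  rewrite -(pmulr_rge0 _ (rho0 m)) (le_trans h)// gerDl.
  by apply: sumr_le0 => j _; rewrite mulr_ge0_le0// subr_le0 hm.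
have Cinj (v : 'cV[R]_n) : C *m v = 0 -> v = 0.
  move=> Cv; apply/matrixP => i j; rewrite ord1 mxE; apply/eqP.
  rewrite eq_le; apply/andP; split; last by apply: minpr => l; rewrite Cv mxE.
  have /minpr/(_ i) : forall l, 0 <= (C *m (- v)) l 0.
    by move=> l; rewrite mulmxN Cv !mxE oppr0.
  by rewrite mxE oppr_ge0.
have Cu : C \in unitmx.
  rewrite -unitmx_tr -row_free_unit -kermx_eq0; apply/rowV0P => u /sub_kermxP.
  move=> uC; apply: trmx_inj; rewrite trmx0; apply: Cinj.
  by rewrite -[C]trmxK -trmx_mul uC trmx0.
(* The column sums of the inverse, that is, the row vector [1^T C^-1]. *)
pose w j := \sum_i invmx C i j.
have inv0 i j : 0 <= invmx C i j.
  have -> : invmx C i j = (invmx C *m delta_mx j (0 : 'I_1)) i 0.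
    by rewrite -colE mxE.
  by apply: minpr => l; rewrite mulmxA mulmxV// mul1mx mxE ler0n.
have w0 j : 0 <= w j by apply: sumr_ge0.
have wC j : w j * (rho j + \sum_l c j l) - \sum_i w i * c i j = 1.
  have : ((const_mx 1 : 'rV[R]_n) *m invmx C *m C) 0 j = 1.
    by rewrite -mulmxA mulVmx// mulmx1 mxE.
  move=> <-; rewrite mxE.
  have wE i : ((const_mx 1 : 'rV[R]_n) *m invmx C) 0 i = w i.
    by rewrite mxE; apply: eq_bigr => l _; rewrite mxE mul1r.
  under [RHS]eq_bigr do rewrite wE mxE mulrBr.
  rewrite sumrB [X in _ = X - _](bigD1 j)//= eqxx.
  rewrite [X in _ = _ + X - _]big1 ?addr0//.
  by move=> i /negbTE->; rewrite mulr0n mulr0.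
(* If [w j] vanished, the left side of [wC] would be nonpositive and could not equal 1. *)
exists w => // j; rewrite lt_def w0 andbT; apply/eqP => wj.
have := wC j; rewrite wj mul0r sub0r => /eqP; rewrite eq_sym => /eqP h.
by have := @ltr01 R; rewrite h oppr_gt0 ltNge sumr_ge0// => i _; rewrite mulr_ge0.
Qed.

(** Diagonal entries are positive by definiteness, so dominance bounds each of them below by [rho]
    plus the absolute off-diagonal entry, and the cross term is absorbed by these absolute
    values. *)
Lemma rquad_coercive (R : realType) (N : nat) (G : game R N)
    (hG : well_posed_game G) (i : 'I_N) :
  exists2 rho, 0 < rho & forall v : 'cV[R]_2,
    rho * \sum_(k < 2) v k 0 ^+ 2 <= \sum_(k < 2) v k 0 * (rquad G i *m v) k 0.
Proof.
have [sym pd] := rquad_posdef hG i.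
have diag_gt0 k : 0 < rquad G i k k.
  have := pd (delta_mx k 0); rewrite trmx_delta -rowE -colE !mxE; apply.
  by apply/eqP => /matrixP/(_ k 0)/eqP; rewrite !mxE !eqxx oner_eq0.
have dom k : 0 < rquad G i k k - \sum_(l < 2 | l != k) `|rquad G i k l|.
  by rewrite subr_gt0 -[ltRHS]gtr0_norm// rquad_dominant.
have [rho rho0 hrho] := finite_lbound dom.
exists rho => // v.
have b01 : rquad G i (lift ord0 ord0) ord0 = rquad G i ord0 (lift ord0 ord0).
  by rewrite -[in LHS]sym mxE.
have := hrho (lift ord0 ord0); have := hrho ord0.
rewrite (big_mkcond (fun l => l != ord0)) (big_mkcond (fun l => l != lift _ _)).
rewrite /= !big_ord_recl !big_ord0 /= !mxE !big_ord_recl !big_ord0 /=.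
rewrite b01.
set a := rquad _ _ _ _; set b := rquad _ _ _ _; set c := rquad _ _ _ _.
set x := v ord0 0; set y := v _ 0.
rewrite ?(add0r, addr0) => h1 h2.
have h1x := ler_wpM2r (sqr_ge0 x) h1; have h2y := ler_wpM2r (sqr_ge0 y) h2.
(* The left side is [|b|] times a perfect square, of [x + y] or [x - y] according to the sign of
   [b]. *)
have hb : 0 <= `|b| * (x ^+ 2 + y ^+ 2) + 2 * b * x * y.
  have [b0|b0] := ger0P b.
    have := mulr_ge0 b0 (sqr_ge0 (x + y)); lra.
  have bn : 0 <= - b by rewrite oppr_ge0 ltW.
  have := mulr_ge0 bn (sqr_ge0 (x - y)); lra.
lra.
Qed.

Lemma mul2r_le (R : realType) (a b : R) : a * b <= (a ^+ 2 + b ^+ 2) / 2.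
Proof. by have := sqr_ge0 (a - b); lra. Qed.

(** From [2 * (v_i^2 - v_i v_j) >= v_i^2 - v_j^2], the coefficient of [v_j^2] in the weighted sum is
    at least [2 w_j rho_j + w_j * sum_l c_jl - sum_i w_i c_ij]. By the choice of weights this equals
    [w_j rho_j + 1]. *)
Lemma grad_lin_coercive (R : realType) (N : nat) (G : game R N)
    (hG : well_posed_game G) :
  exists2 w : 'I_N -> R, forall i, 0 < w i & forall v : profile R N,
    psq v <= \sum_(i < N) \sum_(k < 2) w i * (v i k 0 * grad_lin G i k v).
Proof.
have /choice[rho hrho] : forall i, exists rho, 0 < rho /\ forall v : 'cV[R]_2,
    rho * \sum_(k < 2) v k 0 ^+ 2 <= \sum_(k < 2) v k 0 * (rquad G i *m v) k 0.
  by move=> i; have [rho] := rquad_coercive hG i; exists rho.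
(* Extended by zero, since [cwgt] has a known sign only on the physical neighbors. *)
pose c i j := if j \in pnbr G i then cwgt G i j else 0.
have c0 i j : 0 <= c i j.
  by rewrite /c; case: ifP => // /(cwgt_gt0 hG)/ltW.
have [w w0 hw] := comparison_weights c0 (fun i => (hrho i).1).
exists w => // v.
pose s i := \sum_(k < 2) v i k 0 ^+ 2.
have s0 i : 0 <= s i by apply: sumr_ge0 => k _; exact: sqr_ge0.
have step i : 2 * (w i * (rho i * s i)) + w i * (\sum_j c i j) * s i
      - \sum_j w i * c i j * s j <=
    \sum_(k < 2) w i * (v i k 0 * grad_lin G i k v).
  have -> : \sum_(k < 2) w i * (v i k 0 * grad_lin G i k v) =
      2 * (w i * \sum_(k < 2) v i k 0 * (rquad G i *m v i) k 0)
      + \sum_j w i * c i j * \sum_(k < 2) 2 * (v i k 0 ^+ 2 - v i k 0 * v j k 0).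
    under [X in _ = _ + X]eq_bigr do rewrite mulr_sumr.
    rewrite exchange_big /= !mulr_sumr -big_split /=; apply: eq_bigr => k _.
    rewrite /grad_lin (big_mkcond (fun j => j \in pnbr G i)) /= mulrDr.
    rewrite !mulrDr; congr (_ + _); first by ring.
    rewrite !mulr_sumr; apply: eq_bigr => j _; rewrite /c.
    by case: ifP => _; ring.
  rewrite -addrA lerD//.
    by rewrite ler_pM2l// ler_pM2l//; exact: (hrho i).2.
  rewrite mulrAC mulr_sumr -sumrB; apply: ler_sum => j _.
  rewrite mulrAC -mulrBr ler_wpM2l// ?mulr_ge0// ?(ltW (w0 i))//.
  rewrite /s -sumrB ler_sum// => k _.
  by have := mul2r_le (v i k 0) (v j k 0); lra.
apply: le_trans (ler_sum _ (fun i _ => step i)).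
rewrite sumrB exchange_big /= -sumrB /psq ler_sum// => j _.
rewrite -/(s j) -mulr_suml.
have : 0 <= w j * rho j * s j.
  by rewrite mulr_ge0// mulr_ge0// ltW// (hrho j).1.
have := congr1 ( *%R^~ (s j)) (hw j); rewrite mul1r mulrBl mulrDr; lra.
Qed.

(** The form [Q j] controls the differences of [v] along edges and the values at the neighbors of
    [j]. Node [j] has a neighbor, and connectivity carries the control from it to every node. *)
Lemma graph_coercive (R : realType) (N : nat) (hN : (2 <= N)%N) (A : 'M[R]_N)
    (hA : weighted_graph A) (hundir : undirected A) (hconn : connected_graph A) :
  exists2 lam, 0 < lam & forall (j : 'I_N) (v : 'I_N -> R),
    lam * \sum_i v i ^+ 2 <=
    \sum_i v i * (\sum_k A i k * (v i - v k) + A i j * v i).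
Proof.
have A0 := adj_ge0 hA.
pose Q j (v : 'I_N -> R) :=
  \sum_i v i * (\sum_k A i k * (v i - v k) + A i j * v i).
have QE j v : 2 * Q j v = \sum_i \sum_k A i k * (v i - v k) ^+ 2
    + 2 * \sum_i A i j * v i ^+ 2.
  have -> : Q j v = \sum_i \sum_k A i k * (v i * (v i - v k))
      + \sum_i A i j * v i ^+ 2.
    rewrite -big_split /=; apply: eq_bigr => i _; rewrite mulrDr mulr_sumr.
    by congr (_ + _); [apply: eq_bigr => k _; ring | ring].
  (* Swapping the indices in one of the two copies and using symmetry of [A] produces the squared
     differences. *)
  rewrite mulrDr mulr_natl mulr2n {2}exchange_big /= -!big_split /=.
  congr (_ + _); apply: eq_bigr => i _; rewrite -big_split /=.
  by apply: eq_bigr => k _; rewrite (hundir k i); ring.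
have S0 v : 0 <= \sum_i \sum_k A i k * (v i - v k) ^+ 2.
  by apply: sumr_ge0 => i _; apply: sumr_ge0 => k _; rewrite mulr_ge0 ?sqr_ge0.
have P0 j v : 0 <= \sum_i A i j * v i ^+ 2.
  by apply: sumr_ge0 => i _; rewrite mulr_ge0 ?sqr_ge0.
have Q0 j v : 0 <= Q j v by have := QE j v; have := S0 v; have := P0 j v; lra.
have pinned j i : 0 < A i j -> quad_bounded (Q j) (fun v => v i).
  move=> Aij; exists (A i j)^-1 => [|v]; first by rewrite invr_gt0.
  rewrite mulrC ler_pdivlMr// mulrC.
  have le_i : A i j * v i ^+ 2 <= \sum_i A i j * v i ^+ 2.
    rewrite (bigD1 i)//= lerDl sumr_ge0// => k _; rewrite mulr_ge0 ?sqr_ge0//.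
  by have := QE j v; have := S0 v; lra.
have diffQ j i k : edge A i k -> quad_bounded (Q j) (fun v => v k - v i).
  rewrite /edge => Aki; exists (2 * (A k i)^-1) => [|v].
    by rewrite mulr_gt0 ?invr_gt0.
  rewrite mulrAC ler_pdivlMr// mulrC.
  have le_k : A k i * (v k - v i) ^+ 2 <= \sum_k \sum_i A k i * (v k - v i) ^+ 2.
    rewrite (bigD1 k)//= (bigD1 i)//= -addrA lerDl addr_ge0//.
      by apply: sumr_ge0 => l _; rewrite mulr_ge0 ?sqr_ge0.
    apply: sumr_ge0 => l _; apply: sumr_ge0 => m _.
    by rewrite mulr_ge0 ?sqr_ge0.
  by have := QE j v; have := P0 j v; lra.
have allQ j i : quad_bounded (Q j) (fun v => v i).
  have [l lj] : exists l, l != j.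
    have n0 : (0 < N)%N by exact: leq_trans hN.
    have [j0|j0] := eqVneq j (Ordinal n0).
      by exists (Ordinal hN); rewrite j0.
    by exists (Ordinal n0); rewrite eq_sym.
  (* The first edge of a path from [j] to another node. *)
  have [m Amj] : exists m, 0 < A m j.
    have /hconn/connectP[[|m p]] : j != l by rewrite eq_sym.
      by move=> _ /eqP; rewrite (negbTE lj).
    by move=> /= /andP[jm _] _; exists m.
  have : connect (edge A) m i.
    by have [->|/hconn//] := eqVneq m i; exact: connect0.
  move=> /connectP[p]; have := pinned j m Amj.
  (* Induction along the path from [m] to [i], writing [v k = v m + (v k - v m)]. *)
  elim: p m {Amj} => [|k p IHp] m /= hm; first by move=> _ ->.
  move=> /andP[mk hp] hi; apply: IHp hp hi.
  have -> : (fun v : 'I_N -> R => v k) = (fun v => v m + (v k - v m)).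
    by apply/funext => v; ring.
  exact: quad_boundedD hm (diffQ j m k mk).
have /choice[C hC] : forall j, exists C, 0 < C /\ forall v, \sum_i v i ^+ 2 <= C * Q j v.
  move=> j; have [C C0 hC] := sum_quad_bounded (Q0 j) (allQ j).
  by exists C.
have [lam lam0 hlam] : exists2 lam, 0 < lam & forall j, lam <= (C j)^-1.
  by apply: finite_lbound => j; rewrite invr_gt0 (hC j).1.
exists lam => // j v; rewrite -/(Q j v).
apply: (@le_trans _ _ ((C j)^-1 * \sum_i v i ^+ 2)).
  by rewrite ler_wpM2r// sumr_ge0// => i _; exact: sqr_ge0.
by rewrite mulrC ler_pdivrMr ?(hC j).1// mulrC (hC j).2.
Qed.

(** * The composite Lyapunov function and its two-sided bounds *)

Section Lyapunov.
Context {R : realType} {N : nat}.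
Implicit Types (w al ga : 'I_N -> R) (xi : profile R N).

(** The weights [1 / tb] cancel the gains in the consensus dynamics. The rescaling [sigma * z1]
    makes the observer matrix proportional to [sigma]. *)
Definition lyap w al ga (tb : 'I_N -> 'I_N -> R) (sigma : R) xi
    (eta : 'I_N -> profile R N) (z1 z2 : profile R N) : R :=
  \sum_i \sum_(k < 2) w i * xi i k 0 ^+ 2
  + \sum_i \sum_j \sum_(k < 2) (tb i j)^-1 * eta i j k 0 ^+ 2
  + \sum_i \sum_(k < 2) (al i * (sigma * z1 i k 0) ^+ 2
      - 2 * (sigma * z1 i k 0) * z2 i k 0 + ga i * z2 i k 0 ^+ 2).

Definition lyap_size (sigma : R) xi
    (eta : 'I_N -> profile R N) (z1 z2 : profile R N) : R :=
  psq xi + \sum_i psq (eta i)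
  + \sum_i \sum_(k < 2) ((sigma * z1 i k 0) ^+ 2 + z2 i k 0 ^+ 2).

(** The smallest eigenvalue of the observer block with diagonal [al], [ga] and off-diagonal entry -1
    is at least determinant over trace. Thus [m] does not depend on [sigma]. *)
Lemma lyap_ge w al ga tb :
  (forall i, 0 < w i) -> (forall i j, 0 < tb i j) ->
  (forall i, 0 < al i) -> (forall i, 0 < ga i) -> (forall i, 1 < al i * ga i) ->
  exists2 m, 0 < m & forall sigma xi eta z1 z2,
    m * lyap_size sigma xi eta z1 z2 <= lyap w al ga tb sigma xi eta z1 z2.
Proof.
move=> w0 tb0 al0 ga0 alga.
have [m1 m10 hm1] := finite_lbound w0.
have [m2 m20 hm2] : exists2 m, 0 < m & forall p : 'I_N * 'I_N, m <= (tb p.1 p.2)^-1.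
  by apply: finite_lbound => p; rewrite invr_gt0.
have [m3 m30 hm3] : exists2 m, 0 < m &
    forall i, m <= (al i * ga i - 1) / (al i + ga i).
  by apply: finite_lbound => i; rewrite divr_gt0 ?subr_gt0// addr_gt0.
have [m m0 hm] : exists2 m, 0 < m & [/\ m <= m1, m <= m2 & m <= m3].
  exists (Num.min m1 (Num.min m2 m3)); first by rewrite !lt_min m10 m20.
  by split; rewrite !ge_min lexx ?orbT.
have [le1 le2 le3] := hm.
exists m => // sigma xi eta z1 z2; rewrite /lyap_size /lyap !mulrDr.
apply: lerD; first apply: lerD.
- rewrite mulr_sumr ler_sum// => i _; rewrite mulr_sumr ler_sum// => k _.
  by rewrite ler_wpM2r ?sqr_ge0// (le_trans le1).
- rewrite mulr_sumr ler_sum// => i _; rewrite mulr_sumr ler_sum// => j _.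
  rewrite mulr_sumr ler_sum// => k _.
  by rewrite ler_wpM2r ?sqr_ge0// (le_trans le2)// (hm2 (i, j)).
- rewrite mulr_sumr ler_sum// => i _; rewrite mulr_sumr ler_sum// => k _.
  set a := sigma * _; set b := z2 _ _ _.
  have hi := le_trans le3 (hm3 i).
  have s0 : 0 <= a ^+ 2 + b ^+ 2 by rewrite addr_ge0 ?sqr_ge0.
  apply: le_trans (ler_wpM2r s0 hi) _.
  rewrite mulrAC ler_pdivrMr ?addr_gt0//.
  (* These two squares sum exactly to the difference of the two sides. *)
  have := sqr_ge0 (al i * a - b); have := sqr_ge0 (a - ga i * b); lra.
Qed.

Lemma lyap_le w al ga tb :
  exists2 M, 0 < M & forall sigma xi eta z1 z2,
    lyap w al ga tb sigma xi eta z1 z2 <= M * lyap_size sigma xi eta z1 z2.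
Proof.
have [m1 m10 hm1] := finite_ubound w.
have [m2 m20 hm2] := finite_ubound (fun p : 'I_N * 'I_N => (tb p.1 p.2)^-1).
have [m3 m30 hm3] := finite_ubound (fun i => 1 + `|al i| + `|ga i|).
exists (m1 + m2 + m3); first by rewrite !addr_gt0.
move=> sigma xi eta z1 z2; rewrite /lyap_size /lyap !mulrDr.
apply: lerD; first apply: lerD.
- rewrite mulr_sumr ler_sum// => i _; rewrite mulr_sumr ler_sum// => k _.
  by rewrite ler_wpM2r ?sqr_ge0// (le_trans (hm1 i))// -addrA lerDl addr_ge0// ltW.
- rewrite mulr_sumr ler_sum// => i _; rewrite mulr_sumr ler_sum// => j _.
  rewrite mulr_sumr ler_sum// => k _.
  rewrite ler_wpM2r ?sqr_ge0// (le_trans (hm2 (i, j)))//.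
  by rewrite -addrA addrCA lerDl addr_ge0// ltW.
- rewrite mulr_sumr ler_sum// => i _; rewrite mulr_sumr ler_sum// => k _.
  set a := sigma * _; set b := z2 _ _ _.
  have s0 : 0 <= a ^+ 2 + b ^+ 2 by rewrite addr_ge0 ?sqr_ge0.
  have h3 : 1 + `|al i| + `|ga i| <= m1 + m2 + m3.
    by rewrite (le_trans (hm3 i))// lerDr addr_ge0// ltW.
  apply: le_trans (ler_wpM2r s0 h3).
  have ha : al i * a ^+ 2 <= `|al i| * a ^+ 2 by rewrite ler_wpM2r ?sqr_ge0// ler_norm.
  have hb : ga i * b ^+ 2 <= `|ga i| * b ^+ 2 by rewrite ler_wpM2r ?sqr_ge0// ler_norm.
  have hc : 0 <= `|al i| * b ^+ 2 by rewrite mulr_ge0 ?sqr_ge0.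
  have hd : 0 <= `|ga i| * a ^+ 2 by rewrite mulr_ge0 ?sqr_ge0.
  have := sqr_ge0 (a + b); lra.
Qed.

(** The chain-rule derivative with the velocities as free arguments, so that decay becomes a purely
    algebraic inequality. *)
Definition dlyap w al ga (tb : 'I_N -> 'I_N -> R) (sigma : R) xi
    (eta : 'I_N -> profile R N) (z1 z2 xi' : profile R N)
    (eta' : 'I_N -> profile R N) (z1' z2' : profile R N) : R :=
  \sum_i \sum_(k < 2) w i * (2 * (xi i k 0 * xi' i k 0))
  + \sum_i \sum_j \sum_(k < 2) (tb i j)^-1 * (2 * (eta i j k 0 * eta' i j k 0))
  + \sum_i \sum_(k < 2) (2 * (al i * (sigma * z1 i k 0) * (sigma * z1' i k 0))
      - 2 * (sigma * z1' i k 0 * z2 i k 0 + sigma * z1 i k 0 * z2' i k 0)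
      + 2 * (ga i * (z2 i k 0 * z2' i k 0))).

(** The choice of [al] and [ga] cancels the [a1 * a2] term and leaves [- 2 * sigma] on the diagonal;
    half of it is spent on completing the squares with [d]. *)
Lemma observer_decay (a1 a2 k1 k2 al ga sigma d : R) :
  0 < sigma -> 0 < k1 -> 0 < k2 -> al = (k2 + 1) / k1 -> ga = (al + k1) / k2 ->
  2 * (al * a1 * (sigma * (a2 - k1 * a1)))
  - 2 * (sigma * (a2 - k1 * a1) * a2 + a1 * (d - sigma * k2 * a1))
  + 2 * (ga * (a2 * (d - sigma * k2 * a1)))
  <= - sigma * (a1 ^+ 2 + a2 ^+ 2) + (1 + ga ^+ 2) * d ^+ 2 / sigma.
Proof.
move=> s0 k10 k20 alE gaE.
have e1 : al * k1 = k2 + 1 by rewrite alE divfK// gt_eqF.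
have e2 : ga * k2 = al + k1 by rewrite gaE divfK// gt_eqF.
have -> : 2 * (al * a1 * (sigma * (a2 - k1 * a1)))
  - 2 * (sigma * (a2 - k1 * a1) * a2 + a1 * (d - sigma * k2 * a1))
  + 2 * (ga * (a2 * (d - sigma * k2 * a1))) =
  2 * sigma * (- (al * k1) + k2) * a1 ^+ 2 - 2 * sigma * a2 ^+ 2
  + 2 * sigma * a1 * a2 * (al + k1 - ga * k2) - 2 * a1 * d + 2 * ga * a2 * d by ring.
rewrite e1 e2 -subr_ge0.
have -> : - sigma * (a1 ^+ 2 + a2 ^+ 2) + (1 + ga ^+ 2) * d ^+ 2 / sigma -
  (2 * sigma * (- (k2 + 1) + k2) * a1 ^+ 2 - 2 * sigma * a2 ^+ 2 +
   2 * sigma * a1 * a2 * (al + k1 - (al + k1)) - 2 * a1 * d + 2 * ga * a2 * d) =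
  ((sigma * a1 + d) ^+ 2 + (sigma * a2 - ga * d) ^+ 2) / sigma.
  by field; rewrite gt_eqF.
by rewrite divr_ge0 ?(ltW s0)// addr_ge0 ?sqr_ge0.
Qed.

End Lyapunov.

(** * The linear error system and the decay estimate *)

(** Here [d] stands for the rate of the disturbance, which enters only the equation of [z2]. There
    is no constant term, since the gradients vanish at the equilibrium. *)
Record error_rhs (R : realType) (N : nat) (G : game R N) (A : 'M[R]_N)
    (K : gains R N) (theta sigma : R) (xi : profile R N)
    (eta : 'I_N -> profile R N) (z1 z2 d xi' : profile R N)
    (eta' : 'I_N -> profile R N) (z1' z2' : profile R N) : Prop := {
  xi_rhs : forall i k, xi' i k 0 =
    - (grad_lin G i k (eta i) + grad_lin G i k xi) + z2 i k 0;
  eta_rhs : forall i j k, eta' i j k 0 =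
    - (theta * thetabar K i j)
      * (\sum_l A i l * (eta i j k 0 - eta l j k 0) + A i j * eta i j k 0)
    + (grad_lin G j k (eta j) + grad_lin G j k xi - z2 j k 0);
  z1_rhs : forall i k, z1' i k 0 = z2 i k 0 - sigma * k1 K i * z1 i k 0;
  z2_rhs : forall i k, z2' i k 0 = d i k 0 - sigma ^+ 2 * k2 K i * z1 i k 0 }.

(* With these entries, a1^2 obs_diag - 2 a1 a2 + a2^2 obs_diag2 has derivative
   -2 sigma (a1^2 + a2^2) along a1' = sigma (a2 - k1 a1), a2' = - sigma k2 a1. *)
Definition obs_diag (R : realType) (N : nat) (K : gains R N) (i : 'I_N) : R :=
  (k2 K i + 1) / k1 K i.

Definition obs_diag2 (R : realType) (N : nat) (K : gains R N) (i : 'I_N) : R :=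
  (obs_diag K i + k1 K i) / k2 K i.

Lemma young_le (R : realType) (kap a b : R) : 0 < kap ->
  2 * (a * b) <= kap * a ^+ 2 + b ^+ 2 / kap.
Proof.
move=> k0; rewrite -subr_ge0.
have -> : kap * a ^+ 2 + b ^+ 2 / kap - 2 * (a * b) = (kap * a - b) ^+ 2 / kap.
  by field; rewrite gt_eqF.
by rewrite divr_ge0 ?sqr_ge0 ?ltW.
Qed.

(** Each block is estimated separately by Young inequalities. The coupling terms in [eta] are
    absorbed by a large [theta], those in [z2] by a large [sigma], and those in [xi] by the
    coercivity margin. *)
Lemma lyap_decay (R : realType) (N : nat) (hN : (2 <= N)%N) (G : game R N)
    (hG : well_posed_game G) (A : 'M[R]_N) (hA : weighted_graph A)
    (hundir : undirected A) (hconn : connected_graph A)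
    (K : gains R N) (hK : positive_gains K) :
  exists2 w : 'I_N -> R, forall i, 0 < w i &
  exists2 thetastar : R, 0 < thetastar & exists2 sigma1 : R, 0 < sigma1 &
  exists2 C : R, 0 < C & forall theta sigma, thetastar < theta -> sigma1 < sigma ->
  forall xi eta z1 z2 d xi' eta' z1' z2',
  error_rhs G A K theta sigma xi eta z1 z2 d xi' eta' z1' z2' ->
  dlyap w (obs_diag K) (obs_diag2 K) (thetabar K) sigma
    xi eta z1 z2 xi' eta' z1' z2'
  <= - lyap_size sigma xi eta z1 z2 + C * psq d / sigma.
Proof.
have [w w0 hw] := grad_lin_coercive hG.
have [Cg Cg0 hCg] := grad_lin_sq_le G.
have [lam lam0 hlam] := graph_coercive hN hA hundir hconn.
have [W W0 hW] := finite_ubound w.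
have [T T0 hT] := finite_ubound (fun p : 'I_N * 'I_N => (thetabar K p.1 p.2)^-1).
have [C C0 hC] := finite_ubound (fun i => 1 + obs_diag2 K i ^+ 2).
have N0 : 0 < N%:R :> R by rewrite ltr0n (leq_trans _ hN).
(* Young weight for which the gradients of [xi] in the [N] estimate blocks cost at most [psq xi / 4]
   in total. *)
pose kap := 4 * N%:R * Cg.
have kap0 : 0 < kap by rewrite /kap !mulr_gt0.
(* All coefficients of [H] produced by the [xi] block and by the [eta] block. *)
pose CH := 4 * W ^+ 2 * Cg + (2 + kap) * T ^+ 2 + N%:R * Cg.
have W20 : 0 < 4 * W ^+ 2 :> R by rewrite mulr_gt0// exprn_gt0.
have S0 : 0 < 4 * W ^+ 2 + N%:R + 1 by rewrite !addr_gt0.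
have CH0 : 0 < CH + 1 by rewrite !addr_gt0// !mulr_gt0// ?exprn_gt0// addr_gt0.
exists w => //; exists ((CH + 1) / (2 * lam)).
  by rewrite divr_gt0// mulr_gt0.
(* The coefficient of [psq z2] from the other blocks, plus one for the decay itself. *)
exists (4 * W ^+ 2 + N%:R + 1) => //.
exists C => // theta sigma htheta hsigma xi eta z1 z2 d xi' eta' z1' z2'.
have s0 : 0 < sigma by exact: lt_trans hsigma.
have {}htheta : CH + 1 < 2 * theta * lam.
  by rewrite -mulrA [theta * _]mulrC mulrA mulrC -ltr_pdivrMr ?mulr_gt0.
move=> [xiE etaE z1E z2E].
pose Z := \sum_i \sum_(k < 2) ((sigma * z1 i k 0) ^+ 2 + z2 i k 0 ^+ 2).
pose H := \sum_i psq (eta i).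
have gl_eta : \sum_i \sum_(k < 2) grad_lin G i k (eta i) ^+ 2 <= Cg * H.
  rewrite mulr_sumr ler_sum// => i _; apply: le_trans (hCg (eta i)).
  rewrite [leRHS](bigD1 i)//= lerDl sumr_ge0// => j _.
  by rewrite sumr_ge0// => k _; exact: sqr_ge0.
have partX : \sum_i \sum_(k < 2) w i * (2 * (xi i k 0 * xi' i k 0)) <=
    - (3 / 2) * psq xi + 4 * W ^+ 2 * (Cg * H + psq z2).
  (* The coercive part gives [- 2 * psq xi], of which the remainder consumes a quarter. *)
  have -> : \sum_i \sum_(k < 2) w i * (2 * (xi i k 0 * xi' i k 0)) =
      - (2 * \sum_i \sum_(k < 2) w i * (xi i k 0 * grad_lin G i k xi))
      + \sum_i \sum_(k < 2) 2 * (xi i k 0 * (w i * (z2 i k 0 - grad_lin G i k (eta i)))).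
    rewrite mulr_sumr -sumrN -big_split /=; apply: eq_bigr => i _.
    rewrite mulr_sumr -sumrN -big_split /=; apply: eq_bigr => k _.
    by rewrite xiE; ring.
  have young : \sum_i \sum_(k < 2)
      2 * (xi i k 0 * (w i * (z2 i k 0 - grad_lin G i k (eta i)))) <=
    psq xi / 2 + 4 * W ^+ 2 * (\sum_i \sum_(k < 2) grad_lin G i k (eta i) ^+ 2 + psq z2).
    rewrite /psq -big_split mulr_suml mulr_sumr -big_split /=.
    apply: ler_sum => i _; rewrite -big_split mulr_suml mulr_sumr -big_split /=.
    apply: ler_sum => k _; set g := grad_lin _ _ _ _; set z := z2 _ _ _.
    have half0 : 0 < 2^-1 :> R by rewrite invr_gt0.
    have := young_le (xi i k 0) (w i * (z - g)) half0; rewrite invrK.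
    have wW : w i ^+ 2 <= W ^+ 2.
      by rewrite ler_sqr ?nnegrE ?(ltW W0) ?(ltW (w0 i)).
    have := ler_wpM2r (sqr_ge0 (z - g)) wW; rewrite -exprMn.
    have : 0 <= W ^+ 2 * (z + g) ^+ 2 by rewrite mulr_ge0 ?sqr_ge0.
    lra.
  have hx := hw xi.
  have := ler_wpM2l (ltW W20) gl_eta.
  lra.
have partH : \sum_i \sum_j \sum_(k < 2)
      (thetabar K i j)^-1 * (2 * (eta i j k 0 * eta' i j k 0)) <=
    - (2 * theta * lam) * H + ((2 + kap) * T ^+ 2 + N%:R * Cg) * H
    + psq xi / 4 + N%:R * psq z2.
  have -> : \sum_i \sum_j \sum_(k < 2)
      (thetabar K i j)^-1 * (2 * (eta i j k 0 * eta' i j k 0)) =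
    - (2 * theta * \sum_j \sum_(k < 2) \sum_i eta i j k 0
        * (\sum_l A i l * (eta i j k 0 - eta l j k 0) + A i j * eta i j k 0))
    + \sum_i \sum_j \sum_(k < 2) 2 * ((thetabar K i j)^-1 * eta i j k 0
        * (grad_lin G j k (eta j) + grad_lin G j k xi - z2 j k 0)).
    (* The sum over [i] is moved innermost: for fixed [j] and [k] it is the grounded Laplacian
       form. *)
    under [X in _ = - (_ * X) + _]eq_bigr do rewrite exchange_big.
    rewrite [X in _ = - (_ * X) + _]exchange_big /=.
    rewrite mulr_sumr -sumrN -big_split /=; apply: eq_bigr => i _.
    rewrite mulr_sumr -sumrN -big_split /=; apply: eq_bigr => j _.
    rewrite mulr_sumr -sumrN -big_split /=; apply: eq_bigr => k _.
    by rewrite etaE; field; rewrite gt_eqF// thetabar_gt0.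
  have lap : lam * H <= \sum_j \sum_(k < 2) \sum_i eta i j k 0
        * (\sum_l A i l * (eta i j k 0 - eta l j k 0) + A i j * eta i j k 0).
    rewrite /H /psq exchange_big /= mulr_sumr; apply: ler_sum => j _.
    rewrite exchange_big /= mulr_sumr; apply: ler_sum => k _.
    exact: (hlam j (fun i => eta i j k 0)).
  have young : \sum_i \sum_j \sum_(k < 2) 2 * ((thetabar K i j)^-1 * eta i j k 0
        * (grad_lin G j k (eta j) + grad_lin G j k xi - z2 j k 0)) <=
      \sum_i \sum_j \sum_(k < 2) ((2 + kap) * T ^+ 2 * eta i j k 0 ^+ 2
        + (grad_lin G j k (eta j) ^+ 2 + grad_lin G j k xi ^+ 2 / kap + z2 j k 0 ^+ 2)).
    apply: ler_sum => i _; apply: ler_sum => j _; apply: ler_sum => k _.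
    set g := grad_lin _ _ _ (eta j); set g' := grad_lin _ _ _ _; set z := z2 _ _ _.
    set e := _ * eta i j k 0.
    have eT : e ^+ 2 <= T ^+ 2 * eta i j k 0 ^+ 2.
      rewrite exprMn ler_wpM2r ?sqr_ge0// ler_sqr ?nnegrE ?(ltW T0)//.
        exact: (hT (i, j)).
      by rewrite invr_ge0 ltW// thetabar_gt0.
    have kap2 : 0 <= 2 + kap by rewrite addr_ge0// ltW.
    (* The cross terms with [g], [g'] and [z] cost [1], [kap] and [1] times [e ^+ 2], hence the
       factor [2 + kap]. *)
    have := ler_wpM2l kap2 eT; have := young_le e g' kap0.
    have := sqr_ge0 (e - g); have := sqr_ge0 (e + z).
    lra.
  have sumE : \sum_i \sum_j \sum_(k < 2) ((2 + kap) * T ^+ 2 * eta i j k 0 ^+ 2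
        + (grad_lin G j k (eta j) ^+ 2 + grad_lin G j k xi ^+ 2 / kap + z2 j k 0 ^+ 2)) =
      (2 + kap) * T ^+ 2 * H + N%:R * (\sum_j \sum_(k < 2) grad_lin G j k (eta j) ^+ 2
        + (\sum_j \sum_(k < 2) grad_lin G j k xi ^+ 2) / kap + psq z2).
    have constE (y : R) : N%:R * y = \sum_(i < N) y.
      by rewrite sumr_const card_ord mulr_natl.
    rewrite constE mulr_sumr -big_split /=.
    apply: eq_bigr => i _; rewrite mulr_sumr mulr_suml -!big_split /=.
    by apply: eq_bigr => j _; rewrite mulr_sumr mulr_suml -!big_split.
  have hxi : N%:R * ((\sum_j \sum_(k < 2) grad_lin G j k xi ^+ 2) / kap) <= psq xi / 4.
    rewrite mulrA ler_pdivrMr//.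
    have -> : psq xi / 4 * kap = N%:R * (Cg * psq xi) by rewrite /kap; field.
    by rewrite ler_wpM2l ?(ltW N0).
  have heta := ler_wpM2l (ltW N0) gl_eta.
  have theta0 : 0 < theta.
    by rewrite -(pmulr_lgt0 _ lam0) -(pmulr_rgt0 _ (ltr0Sn R 1)) mulrA (lt_trans CH0).
  have := ler_wpM2l (ltW theta0) lap.
  move: young; rewrite sumE; lra.
have partZ : \sum_i \sum_(k < 2)
      (2 * (obs_diag K i * (sigma * z1 i k 0) * (sigma * z1' i k 0))
      - 2 * (sigma * z1' i k 0 * z2 i k 0 + sigma * z1 i k 0 * z2' i k 0)
      + 2 * (obs_diag2 K i * (z2 i k 0 * z2' i k 0))) <=
   - sigma * Z
   + C * psq d / sigma.
  rewrite mulr_sumr [C * _]mulr_sumr mulr_suml -big_split /=; apply: ler_sum => i _.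
  rewrite !mulr_sumr mulr_suml -big_split /=; apply: ler_sum => k _.
  rewrite z1E z2E.
  have -> : sigma * (z2 i k 0 - sigma * k1 K i * z1 i k 0) =
    sigma * (z2 i k 0 - k1 K i * (sigma * z1 i k 0)) by ring.
  have -> : d i k 0 - sigma ^+ 2 * k2 K i * z1 i k 0 =
    d i k 0 - sigma * k2 K i * (sigma * z1 i k 0) by ring.
  have k10 := k1_gt0 hK i; have k20 := k2_gt0 hK i.
  apply: le_trans (observer_decay _ _ _ s0 k10 k20 erefl erefl) _.
  rewrite lerD2l ler_wpM2r ?invr_ge0 ?(ltW s0)// ler_wpM2r ?sqr_ge0//.
  exact: (hC i).
have H0 : 0 <= H by apply: sumr_ge0 => i _; exact: psq_ge0.
rewrite /dlyap /lyap_size -/H -/Z.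
have hZ : psq z2 <= Z.
  rewrite /Z; apply: ler_sum => i _; apply: ler_sum => k _.
  by rewrite lerDr sqr_ge0.
have psqz := psq_ge0 z2; have psqx := psq_ge0 xi.
have hH := ler_wpM2r H0 (ltW htheta).
have hS : (4 * W ^+ 2 + N%:R + 1) * Z <= sigma * Z.
  by rewrite ler_wpM2r ?(ltW hsigma)// (le_trans psqz).
have hZ' : (4 * W ^+ 2 + N%:R) * psq z2 <= (4 * W ^+ 2 + N%:R) * Z.
  by rewrite ler_wpM2l// ltW// addr_gt0.
rewrite /CH in hH; lra.
Qed.

(** * Differentiation on a half-line and a Gronwall bound *)

Section OneSidedDerivative.
Context {R : realType} (t0 : R).
Implicit Types (f g df dg : R -> R).

(** Right continuity suffices at [t0]: the monotonicity argument needs derivatives only in the open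
    half-line. *)
Definition deriv_after f df :=
  (forall t, t0 < t -> is_derive t 1 f (df t)) /\ f @ t0^'+ --> f t0.

Lemma deriv_after_cst (c : R) : deriv_after (fun=> c) (fun=> 0).
Proof. by split => [t _|]; [exact: is_derive_cst | exact: cvg_cst]. Qed.

Lemma deriv_afterD f g df dg : deriv_after f df -> deriv_after g dg ->
  deriv_after (fun t => f t + g t) (fun t => df t + dg t).
Proof.
move=> [Df cf] [Dg cg]; split; last exact: cvgD.
by move=> t ht; have hf := Df t ht; have hg := Dg t ht; exact: is_deriveD.
Qed.

Lemma deriv_afterM f g df dg : deriv_after f df -> deriv_after g dg ->
  deriv_after (fun t => f t * g t) (fun t => df t * g t + f t * dg t).
Proof.
move=> [Df cf] [Dg cg]; split; last exact: cvgM.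
move=> t ht; have hf := Df t ht; have hg := Dg t ht.
apply: (is_derive_eq (is_deriveM hf hg)).
rewrite /GRing.scale /=; ring.
Qed.

Lemma deriv_after_eq f df dg : (forall t, df t = dg t) ->
  deriv_after f df -> deriv_after f dg.
Proof. by move=> /funext ->. Qed.

Lemma deriv_afterZ (c : R) f df : deriv_after f df ->
  deriv_after (fun t => c * f t) (fun t => c * df t).
Proof.
move=> hf; apply: deriv_after_eq (deriv_afterM (deriv_after_cst c) hf) => t.
by rewrite mul0r add0r.
Qed.

Lemma deriv_after_sum (I : Type) (s : seq I) (F dF : I -> R -> R) :
  (forall i, deriv_after (F i) (dF i)) ->
  deriv_after (fun t => \sum_(i <- s) F i t) (fun t => \sum_(i <- s) dF i t).
Proof.
move=> hF; elim: s => [|i s IHs].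
  have -> : (fun t => \sum_(i <- [::]) F i t) = (fun=> 0).
    by apply/funext => t; rewrite big_nil.
  apply: deriv_after_eq (deriv_after_cst 0) => t; by rewrite big_nil.
have -> : (fun t => \sum_(j <- i :: s) F j t) =
    (fun t => F i t + \sum_(j <- s) F j t).
  by apply/funext => t; rewrite big_cons.
by apply: deriv_after_eq (deriv_afterD (hF i) IHs) => t; rewrite big_cons.
Qed.

Lemma coord_deriv_from (n : nat) (f : R -> 'cV[R]_n) (k : 'I_n) (t : R)
    (l : 'cV[R]_n) : has_deriv_from t0 f t l ->
  (s - t)^-1 * (f s k 0 - f t k 0) @[s --> within `[t0, +oo[ t^'] --> l k 0.
Proof.
move=> h.
have -> : (fun s => (s - t)^-1 * (f s k 0 - f t k 0)) =
    (fun v : 'cV[R]_n => v k 0) \o (fun s => (s - t)^-1 *: (f s - f t)).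
  by apply/funext => s; rewrite /= !mxE.
by apply: cvg_comp; [exact: h | exact: coord_continuous].
Qed.

(** For [t > t0] the restriction to the half-line is inactive near [t], so the derivative is
    two-sided. At [t0], the increment is [s - t0] times a convergent quotient and tends to 0. *)
Lemma deriv_after_coord (n : nat) (f df : R -> 'cV[R]_n) (k : 'I_n) :
  (forall t, t0 <= t -> has_deriv_from t0 f t (df t)) ->
  deriv_after (fun t => f t k 0) (fun t => df t k 0).
Proof.
move=> h; split.
  move=> t tt0; have H := coord_deriv_from (k := k) (h t (ltW tt0)).
  have lim : (fun u => u^-1 *: (((fun t => f t k 0) \o shift t) (u *: 1) - f t k 0)) @ 0^'
      --> df t k 0.
    have -> : (fun u => u^-1 *: (((fun t => f t k 0) \o shift t) (u *: 1) - f t k 0)) =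
        (fun s => (s - t)^-1 * (f s k 0 - f t k 0)) \o (fun u => u + t).
      by apply/funext => u /=; rewrite addrK /GRing.scale /= mulr1.
    apply: cvg_comp; last exact: H.
    move=> P hP.
    have sh : (u + t) @[u --> (0 : R)] --> t.
      rewrite -[X in _ --> X]add0r; apply: cvgD; [exact: cvg_id|exact: cvg_cst].
    have hP' : \forall s \near t, s != t -> s \in `[t0, +oo[ -> P s := hP.
    have gt_t0 : \forall s \near t, t0 < s by exact: lt_nbhsr.
    have gt_u : \forall u \near (0 : R), t0 < u + t := sh _ gt_t0.
    have P_u : \forall u \near (0 : R),
      u + t != t -> u + t \in `[t0, +oo[ -> P (u + t) := sh _ hP'.
    suff: \forall u \near (0 : R), u != 0 -> P (u + t) by [].
    apply: filterS2 P_u gt_u => u Pu ut u0; apply: Pu.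
      by rewrite -subr_eq0 addrK.
    by rewrite in_itv /= andbT ltW.
  apply: DeriveDef; first by apply/cvg_ex; exists (df t k 0).
  exact: cvg_lim lim.
have H := coord_deriv_from (k := k) (h t0 (lexx _)).
have {}H : (s - t0)^-1 * (f s k 0 - f t0 k 0) @[s --> t0^'+] --> df t0 k 0.
  apply: (cvg_trans _ H); apply: cvg_fmap2 => P hP.
  have {}hP : \forall s \near t0, s != t0 -> s \in `[t0, +oo[ -> P s := hP.
  suff : \forall s \near t0, t0 < s -> P s by [].
  apply: filterS hP => s Ps ts; apply: Ps; first by rewrite gt_eqF.
  by rewrite /= in_itv /= andbT ltW.
have S : s - t0 @[s --> t0^'+] --> (0 : R).
  rewrite -(subrr t0); apply: cvgB; last exact: cvg_cst.
  exact: cvg_within.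
have : f t0 k 0 + (s - t0) * ((s - t0)^-1 * (f s k 0 - f t0 k 0)) @[s --> t0^'+]
    --> f t0 k 0 + 0 * df t0 k 0.
  by apply: cvgD; [exact: cvg_cst | exact: cvgM].
rewrite mul0r addr0 => hl; apply: (cvg_trans _ hl); apply: near_eq_cvg; near=> s.
have : s - t0 != 0.
  rewrite subr_eq0 gt_eqF//; near: s; exact: nbhs_right_gt.
by move=> s0; rewrite /= mulrA mulfV// mul1r addrC subrK.
Unshelve. all: by end_near. Qed.

(** The function [(V - eps / c)] times the exponential of [c * (t - t0)] has nonpositive
    derivative. *)
Lemma gronwall (V dV : R -> R) (c eps : R) : 0 < c -> 0 <= eps ->
  deriv_after V dV ->
  (forall t, t0 < t -> dV t <= - c * V t + eps) ->
  forall t, t0 <= t -> V t <= V t0 * expR (- (c * (t - t0))) + eps / c.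
Proof.
move=> c0 eps0 [DV cV] hV t ht.
pose W s := (V s - eps / c) * expR (c * (s - t0)).
have DE (s : R) : is_derive s 1 (fun s => expR (c * (s - t0))) (c * expR (c * (s - t0))).
  have h1 : is_derive s 1 (fun s => c * (s - t0)) c.
    have h2 : is_derive s 1 (shift (- t0) : R -> R) 1 := is_derive_shift _ _ _.
    apply: (is_derive_eq (is_deriveZ c h2)); by rewrite /GRing.scale /= mulr1.
  apply: (is_derive_eq (is_derive1_comp (is_derive_expR _) h1)).
  by rewrite mulrC.
have DW s : t0 < s -> is_derive s 1 W
    (dV s * expR (c * (s - t0)) + (V s - eps / c) * (c * expR (c * (s - t0)))).
  move=> hs; have hd := DV s hs; have hE := DE s.
  have hc : is_derive s 1 (fun=> eps / c) 0 := is_derive_cst _ _ _.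
  apply: (is_derive_eq (is_deriveM (is_deriveB hd hc) hE)).
  by rewrite subr0 /GRing.scale /= addrC [dV s * _]mulrC.
have WW s : t0 < s -> dV s * expR (c * (s - t0))
    + (V s - eps / c) * (c * expR (c * (s - t0))) <= 0.
  move=> hs; rewrite mulrA -mulrDl mulr_le0_ge0 ?expR_ge0//.
  have -> : (V s - eps / c) * c = c * V s - eps by field; rewrite gt_eqF.
  by have := hV s hs; lra.
have decr : W t <= W t0.
  apply: (@ler0_derive1_nincry _ W t0) => //.
  - by move=> s; rewrite in_itv /= andbT => /DW hs; exact: ex_derive.
  - move=> s; rewrite in_itv /= andbT => hs; have hW := DW s hs.
    by rewrite derive1E derive_val WW.
  - apply: derivable_oy_Rcontinuous_within_itvcy; split.
      by move=> s; rewrite in_itv /= andbT => /DW hs; exact: ex_derive.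
    apply: cvgM; first by apply: cvgB => //; exact: cvg_cst.
    apply: cvg_at_right_filter.
    have hE := DE t0.
    have dE : derivable (fun s => expR (c * (s - t0))) t0 1 by exact: ex_derive.
    by move/derivable1_diffP/differentiable_continuous : dE.
have E0 : 0 < expR (- (c * (t - t0))) := expR_gt0 _.
move: decr; rewrite /W subrr mulr0 expR0 mulr1 => /(ler_wpM2r (ltW E0)).
rewrite -mulrA -expRD subrr expR0 mulr1 mulrBl.
have : 0 <= eps / c * expR (- (c * (t - t0))).
  by rewrite !mulr_ge0 ?invr_ge0 ?expR_ge0// ltW.
lra.
Qed.

End OneSidedDerivative.

(** * The Lyapunov function along the closed loop *)

Lemma deriv_after_sqr (R : realType) (t0 : R) (f df : R -> R) :
  deriv_after t0 f df ->
  deriv_after t0 (fun t => f t ^+ 2) (fun t => 2 * (f t * df t)).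
Proof.
move=> hf; have -> : (fun t => f t ^+ 2) = (fun t => f t * f t).
  by apply/funext => t; rewrite expr2.
by apply: deriv_after_eq (deriv_afterM hf hf) => t; ring.
Qed.

Lemma has_deriv_fromB (R : realType) (t0 : R) (n : nat) (f g : R -> 'cV[R]_n)
    (t : R) (l m : 'cV[R]_n) :
  has_deriv_from t0 f t l -> has_deriv_from t0 g t m ->
  has_deriv_from t0 (fun s => f s - g s) t (l - m).
Proof.
move=> hf hg; rewrite /has_deriv_from.
have -> : (fun s => (s - t)^-1 *: (f s - g s - (f t - g t))) =
    (fun s => (s - t)^-1 *: (f s - f t) - (s - t)^-1 *: (g s - g t)).
  apply/funext => s; rewrite -scalerBr; congr (_ *: _).
  by rewrite !opprD !opprK addrACA.
exact: cvgB hf hg.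
Qed.

Lemma has_deriv_from_cst (R : realType) (t0 : R) (n : nat) (c : 'cV[R]_n) (t : R) :
  has_deriv_from t0 (fun=> c) t 0.
Proof.
rewrite /has_deriv_from; have -> : (fun s => (s - t)^-1 *: (c - c)) = (fun=> 0).
  by apply/funext => s; rewrite subrr scaler0.
exact: cvg_cst.
Qed.

Lemma deriv_after_lyap (R : realType) (N : nat) (t0 : R) (w al ga : 'I_N -> R)
    (tb : 'I_N -> 'I_N -> R) (sigma : R)
    (xi z1 z2 xi' z1' z2' : R -> profile R N)
    (eta eta' : R -> 'I_N -> profile R N) :
  (forall i k, deriv_after t0 (fun t => xi t i k 0) (fun t => xi' t i k 0)) ->
  (forall i j k, deriv_after t0 (fun t => eta t i j k 0) (fun t => eta' t i j k 0)) ->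
  (forall i k, deriv_after t0 (fun t => z1 t i k 0) (fun t => z1' t i k 0)) ->
  (forall i k, deriv_after t0 (fun t => z2 t i k 0) (fun t => z2' t i k 0)) ->
  deriv_after t0
    (fun t => lyap w al ga tb sigma (xi t) (eta t) (z1 t) (z2 t))
    (fun t => dlyap w al ga tb sigma (xi t) (eta t) (z1 t) (z2 t)
      (xi' t) (eta' t) (z1' t) (z2' t)).
Proof.
move=> hxi heta hz1 hz2; rewrite /lyap /dlyap.
apply: deriv_afterD; first apply: deriv_afterD.
- do 2! apply: deriv_after_sum => ?.
  by apply: deriv_afterZ; apply: deriv_after_sqr.
- do 3! apply: deriv_after_sum => ?.
  by apply: deriv_afterZ; apply: deriv_after_sqr.
- apply: deriv_after_sum => i; apply: deriv_after_sum => k.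
  have h1 := deriv_afterZ sigma (hz1 i k); have h2 := hz2 i k.
  have -> : (fun t => al i * (sigma * z1 t i k 0) ^+ 2
      - 2 * (sigma * z1 t i k 0) * z2 t i k 0 + ga i * z2 t i k 0 ^+ 2) =
    (fun t => al i * (sigma * z1 t i k 0) ^+ 2
      + (- 2) * ((sigma * z1 t i k 0) * z2 t i k 0) + ga i * z2 t i k 0 ^+ 2).
    by apply/funext => t; ring.
  apply: deriv_after_eq (deriv_afterD (deriv_afterD
    (deriv_afterZ (al i) (deriv_after_sqr h1))
    (deriv_afterZ (- 2) (deriv_afterM h1 h2)))
    (deriv_afterZ (ga i) (deriv_after_sqr h2))) => t.
  by ring.
Qed.

(** Writing each estimate as [eta + xi + xstar] splits the affine gradient, and its value at [xstar]
    is zero. The velocities, including [v i - 0], keep the shape given by the difference rule. *)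
Lemma closed_loop_error_rhs (R : realType) (N : nat) (G : game R N)
    (hG : well_posed_game G) (xstar : profile R N)
    (hxstar : is_nash (cost G) xstar) (A : 'M[R]_N) (K : gains R N)
    (theta sigma : R) (s : state R N) (z z' : profile R N) :
  let v i := control (cost G) i s + z i in
  error_rhs G A K theta sigma
    (fun i => pos s i - xstar i) (fun i j => est s i j - pos s j)
    (fun i => pos s i - xhat s i) (fun i => z i - zhat s i) z'
    (fun i => v i - 0)
    (fun i j => - (theta * thetabar K i j) *:
         (\sum_(k < N) A i k *: (est s i j - est s k j)
          + A i j *: (est s i j - pos s j)) - v j)
    (fun i => v i - (control (cost G) i s + zhat s i
       + (sigma * k1 K i) *: (pos s i - xhat s i)))
    (fun i => z' i - (sigma ^+ 2 * k2 K i) *: (pos s i - xhat s i)).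
Proof.
move=> v.
have vE i k : v i k 0 = - (grad_lin G i k (fun j => est s i j - pos s j)
    + grad_lin G i k (fun j => pos s j - xstar j)) + (z i - zhat s i) k 0.
  rewrite /v /control !grad_lin_sub.
  have gE := partial_grad_cost hG i k (est s i).
  have nE := grad_nash hG hxstar i k.
  set g := partial_grad _ _ _ in gE *.
  have -> : (- g - zhat s i + z i) k 0 = - g k 0 - zhat s i k 0 + z i k 0.
    by rewrite !mxE.
  have -> : (z i - zhat s i) k 0 = z i k 0 - zhat s i k 0 by rewrite !mxE.
  rewrite gE; lra.
split=> [i k|i j k|i k|i k].
- by rewrite subr0.
- have -> (a b : 'cV[R]_2) : (a - b) k 0 = a k 0 - b k 0 by rewrite !mxE.
  rewrite vE opprD opprK; congr (_ + _).
  rewrite mxE; congr (_ * _); rewrite mxE summxE mxE; congr (_ + _).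
  by apply: eq_bigr => l _; rewrite !mxE; ring.
- by rewrite /v !mxE; ring.
- by rewrite !mxE; ring.
Qed.

Lemma disturbance_rate_le (R : realType) (N : nat) (t0 : R)
    (d : 'I_N -> R -> 'cV[R]_2) (hd : forall i, C1_bounded_deriv_from t0 (d i)) :
  exists d' : R -> profile R N,
    (forall i t, t0 <= t -> has_deriv_from t0 (d i) t (d' t i)) /\
    exists2 M, 0 < M & forall t, t0 <= t -> psq (d' t) <= M.
Proof.
have /choice[d' hd'] : forall i, exists d' : R -> 'cV[R]_2,
    (forall t, t0 <= t -> has_deriv_from t0 (d i) t (d' t)) /\
    exists M : R, forall t, t0 <= t -> enorm (d' t) <= M.
  by move=> i; have [d' [hd' _ M]] := hd i; exists d'.
have /choice[M hM] := fun i => (hd' i).2.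
exists (fun t i => d' i t); split=> [i|]; first exact: (hd' i).1.
exists (1 + \sum_i M i ^+ 2) => [|t ht].
  by rewrite ltr_wpDr// sumr_ge0// => i _; exact: sqr_ge0.
rewrite ler_wpDl// /psq ler_sum// => i _; rewrite -sqr_enorm.
by rewrite ler_sqr ?nnegrE ?enorm_ge0 ?(le_trans (enorm_ge0 _) (hM i t ht)) ?hM.
Qed.

(** * Choice of the thresholds and the ultimate bound *)

Theorem corollary2 (R : realType) (N : nat) (hN : (2 <= N)%N)
    (G : game R N) (hG : well_posed_game G)
    (xstar : profile R N) (hxstar : is_nash (cost G) xstar)
    (A : 'M[R]_N) (hA : weighted_graph A)
    (hundir : undirected A) (hconn : connected_graph A)
    (K : gains R N) (hK : positive_gains K)
    (t0 : R) (d : 'I_N -> R -> 'cV[R]_2)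
    (hd : forall i, C1_bounded_deriv_from t0 (d i)) :
  exists2 thetastar : R, 0 < thetastar &
  forall v1 : R, 0 < v1 ->
  exists2 sigmastar : R, 0 < sigmastar &
  forall theta sigma : R, thetastar < theta -> sigmastar < sigma ->
  forall S0 : state R N,
  exists2 Tbar : R, t0 <= Tbar &
  forall S : R -> state R N,
    closed_loop (cost G) A K theta sigma t0 d S -> S t0 = S0 ->
  forall t : R, Tbar < t -> enorm (error xstar (d^~ t) (S t)) <= v1.
Proof.
have [d' [hd' [Md Md0 hMd]]] := disturbance_rate_le hd.
have [w w0 [thetastar theta0 [sigma1 sigma10 [C C0 decay]]]] :=
  lyap_decay hN hG hA hundir hconn hK.
have al0 i : 0 < obs_diag K i.
  by rewrite divr_gt0 ?addr_gt0 ?k1_gt0 ?k2_gt0.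
have ga0 i : 0 < obs_diag2 K i.
  by rewrite divr_gt0 ?addr_gt0 ?k1_gt0 ?k2_gt0.
(* With [a = obs_diag K i] the product is [(a^2 + k2 + 1) / k2]. *)
have alga i : 1 < obs_diag K i * obs_diag2 K i.
  have k10 := k1_gt0 hK i; have k20 := k2_gt0 hK i.
  rewrite /obs_diag2 mulrA ltr_pdivlMr// mul1r mulrDr.
  have -> : obs_diag K i * k1 K i = k2 K i + 1 by rewrite divfK// gt_eqF.
  by rewrite addrCA ltrDl addr_gt0// mulr_gt0.
have [m m0 hm] := lyap_ge w0 (thetabar_gt0 hK) al0 ga0 alga.
have [M M0 hM] := lyap_le w (obs_diag K) (obs_diag2 K) (thetabar K).
exists thetastar => // v1 v10.
(* Half of the admissible level: one share for the transient, one for the residual. *)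
pose delta := m * v1 ^+ 2 / 2.
have delta0 : 0 < delta by rewrite divr_gt0// mulr_gt0// exprn_gt0.
have sg0 : 0 < C * Md * M / delta by rewrite divr_gt0// !mulr_gt0.
(* The summands ensure, in order, the decay estimate, [1 < sigma], and a residual of at most
   [delta]. *)
exists (sigma1 + 1 + C * Md * M / delta); first by rewrite !addr_gt0.
move=> theta sigma htheta hsigma S0.
have s1 : sigma1 < sigma.
  by apply: le_lt_trans hsigma; rewrite -addrA lerDl addr_ge0// ltW.
have s2 : 1 < sigma.
  by apply: le_lt_trans hsigma; rewrite addrAC lerDr addr_ge0// ltW.
have s3 : C * Md * M / delta < sigma.
  by apply: le_lt_trans hsigma; rewrite lerDr addr_ge0// ltW.
have s0 : 0 < sigma by exact: lt_trans s2.
pose E t (s : state R N) :=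
  lyap w (obs_diag K) (obs_diag2 K) (thetabar K) sigma
    (fun i => pos s i - xstar i) (fun i j => est s i j - pos s j)
    (fun i => pos s i - xhat s i) (fun i => d i t - zhat s i).
(* By [1 + x <= expR x] the transient is below [delta] after this time, which depends on the initial
   state but not on the trajectory. *)
exists (t0 + M * `|E t0 S0| / delta).
  by rewrite lerDl divr_ge0 ?(ltW delta0)// mulr_ge0// ltW.
move=> S hS S0E t ht.
have tt0 : t0 <= t.
  apply: ltW; apply: le_lt_trans ht.
  by rewrite lerDl divr_ge0 ?(ltW delta0)// mulr_ge0// ltW.
pose v s i : 'cV[R]_2 := control (cost G) i (S s) + d i s.
pose dE s := dlyap w (obs_diag K) (obs_diag2 K) (thetabar K) sigma
    (fun i => pos (S s) i - xstar i) (fun i j => est (S s) i j - pos (S s) j)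
    (fun i => pos (S s) i - xhat (S s) i) (fun i => d i s - zhat (S s) i)
    (fun i => v s i - 0)
    (fun i j => - (theta * thetabar K i j) *:
         (\sum_(k < N) A i k *: (est (S s) i j - est (S s) k j)
          + A i j *: (est (S s) i j - pos (S s) j)) - v s j)
    (fun i => v s i - (control (cost G) i (S s) + zhat (S s) i
       + (sigma * k1 K i) *: (pos (S s) i - xhat (S s) i)))
    (fun i => d' s i - (sigma ^+ 2 * k2 K i) *: (pos (S s) i - xhat (S s) i)).
have hE : deriv_after t0 (fun s => E s (S s)) dE.
  apply: deriv_after_lyap => [i k|i j k|i k|i k];
    apply: deriv_after_coord => s hs; apply: has_deriv_fromB.
  - exact: pos_dyn hS _ _ hs.
  - exact: has_deriv_from_cst.
  - exact: est_dyn hS _ _ _ hs.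
  - exact: pos_dyn hS _ _ hs.
  - exact: pos_dyn hS _ _ hs.
  - exact: xhat_dyn hS _ _ hs.
  - exact: hd'.
  - exact: zhat_dyn hS _ _ hs.
have Minv0 : 0 < M^-1 by rewrite invr_gt0.
have eps0 : 0 <= C * Md / sigma by rewrite divr_ge0 ?mulr_ge0 ?ltW.
have := gronwall Minv0 eps0 hE _ tt0; rewrite S0E => bound.
have {}bound : E t (S t) <=
    E t0 S0 * expR (- (M^-1 * (t - t0))) + C * Md / sigma / M^-1.
  apply: bound => s hs.
  have := decay theta sigma htheta s1 _ _ _ _ _ _ _ _ _
    (closed_loop_error_rhs hG hxstar A K theta sigma (S s) (d^~ s) (d' s)).
  (* The upper bound [M] on the Lyapunov function turns decay in [lyap_size] into decay at rate
     [1 / M]. *)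
  move=> /le_trans; apply; apply: lerD.
    rewrite mulNr lerN2 mulrC ler_pdivrMr// mulrC; exact: hM.
  by rewrite ler_wpM2r ?invr_ge0 ?(ltW s0)// ler_wpM2l ?(ltW C0)// hMd// ltW.
have b2 : C * Md / sigma / M^-1 <= delta.
  by rewrite invrK mulrAC ler_pdivrMr// [leRHS]mulrC -ler_pdivrMr// ltW.
have b1 : E t0 S0 * expR (- (M^-1 * (t - t0))) <= delta.
  rewrite expRN ler_pdivrMr ?expR_gt0//.
  apply: le_trans (ler_norm _) _.
  have h : M * `|E t0 S0| / delta <= t - t0 by rewrite lerBrDl ltW.
  rewrite mulrC -ler_pdivrMr// (le_trans _ (expR_ge1Dx _))// ler_wpDl//.
  by rewrite ler_pdivlMl// mulrA.
have size : m * lyap_size sigma (fun i => pos (S t) i - xstar i)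
    (fun i j => est (S t) i j - pos (S t) j)
    (fun i => pos (S t) i - xhat (S t) i) (fun i => d i t - zhat (S t) i) <=
    m * v1 ^+ 2.
  apply: le_trans (hm _ _ _ _ _) _; rewrite -/(E t (S t)).
  by move: bound b1 b2; rewrite /delta; lra.
rewrite ler_pM2l// in size.
rewrite -ler_sqr ?nnegrE ?enorm_ge0 ?(ltW v10)//.
apply: le_trans size; rewrite sqr_enorm_error /lyap_size [leRHS]addrC.
apply: lerD; last by rewrite addrC.
rewrite /psq -big_split /=; apply: ler_sum => i _.
rewrite -big_split /=; apply: ler_sum => k _.
(* Since [1 < sigma], the unscaled [zeta_1] is bounded by its rescaled version. *)
rewrite lerD2r exprMn ler_peMl ?sqr_ge0// -[leLHS](expr1n _ 2).
by rewrite ler_sqr ?nnegrE ?(ltW s0)// ltW.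
Qed.
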